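(* Let $R$ be a ring and let $\mathcal{X}$ be a class of left $R$-modules that is closed under extensions, quotients and direct limits. Then every complex $B$ of left $R$-modules has an $\mathcal{X}$-injective envelope, i.e. there is a morphism $\phi: B \to T$ with $T$ an $\mathcal{X}$-injective complex such that (1) for every $\mathcal{X}$-injective complex $T'$ and every morphism $f: B \to T'$ there is a morphism $g: T \to T'$ with $g\phi = f$, and (2) every endomorphism $h: T \to T$ with $h\phi = \phi$ is an automorphism.
   Context: An $\mathcal{X}$-complex is a complex $C$ of $R$-modules with $C^i \in \mathcal{X}$ for all $i \in \mathbb{Z}$; the class of these is $C(\mathcal{X})$. A complex $C$ is $\mathcal{X}$-injective if $\mathrm{Ext}^1(D, C) = 0$ for every $D \in C(\mathcal{X})$, where $\mathrm{Ext}^1$ is computed in the abelian category of complexes of $R$-modules (equivalently, every short exact sequence of complexes $0 \to C \to Y \to D \to 0$ with $D \in C(\mathcal{X})$ splits). A morphism $\phi: M \to T$ with $T$ in a class $\mathcal{F}$ is an $\mathcal{F}$-preenvelope if property (1) holds for all $T' \in \mathcal{F}$; it is an envelope if moreover (2) holds. *)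

(* Defs.v *)
From HB Require Import structures.
From mathcomp Require Import all_boot all_order all_algebra.
Set Implicit Arguments. Unset Strict Implicit. Unset Printing Implicit Defensive.
Import GRing.Theory.
Local Open Scope ring_scope.

Section Defs.
Variable R : pzRingType.

Definition mclass := lmodType R -> Prop.

Definition ses_mod (A B C : lmodType R) (f : {linear A -> B}) (g : {linear B -> C}) :=
  injective f /\ (forall y, exists x, g x = y) /\
  (forall y : B, g y = 0 <-> exists x, f x = y).

Definition closed_ext (X : mclass) :=
  forall (A B C : lmodType R) (f : {linear A -> B}) (g : {linear B -> C}),
    ses_mod f g -> X A -> X C -> X B.

Definition closed_quot (X : mclass) :=
  forall (M N : lmodType R) (f : {linear M -> N}),
    (forall y, exists x, f x = y) -> X M -> X N.

Record dir_system := DirSystem {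
  ds_I : Type;
  ds_le : ds_I -> ds_I -> Prop;
  ds_refl : forall i, ds_le i i;
  ds_trans : forall i j k, ds_le i j -> ds_le j k -> ds_le i k;
  ds_ne : exists i : ds_I, True;
  ds_dir : forall i j, exists k, ds_le i k /\ ds_le j k;
  ds_M : ds_I -> lmodType R;
  ds_map : forall i j, ds_le i j -> {linear ds_M i -> ds_M j};
  ds_id : forall i (h : ds_le i i) x, ds_map h x = x;
  ds_comp : forall i j k (hij : ds_le i j) (hjk : ds_le j k) (hik : ds_le i k) x,
      ds_map hik x = ds_map hjk (ds_map hij x)
}.

Arguments ds_M : clear implicits.
Arguments ds_le : clear implicits.

Definition compatible (S : dir_system) (N : lmodType R)
    (v : forall i, {linear ds_M S i -> N}) :=
  forall i j (h : ds_le S i j) x, v j (ds_map h x) = v i x.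

Definition is_dirlim (S : dir_system) (L : lmodType R)
    (u : forall i, {linear ds_M S i -> L}) :=
  compatible u /\
  forall (N : lmodType R) (v : forall i, {linear ds_M S i -> N}),
    compatible v ->
    (exists t : {linear L -> N}, forall i x, t (u i x) = v i x) /\
    (forall t1 t2 : {linear L -> N},
        (forall i x, t1 (u i x) = v i x) -> (forall i x, t2 (u i x) = v i x) ->
        forall y, t1 y = t2 y).

Definition closed_dirlim (X : mclass) :=
  forall (S : dir_system) (L : lmodType R) (u : forall i, {linear ds_M S i -> L}),
    (forall i, X (ds_M S i)) -> is_dirlim u -> X L.

Record complex := Complex {
  cobj : int -> lmodType R;
  cd : forall i, {linear cobj i -> cobj (i + 1)};
  cdd : forall i x, cd (i + 1) (cd i x) = 0
}.

Arguments cobj : clear implicits.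
Arguments cd : clear implicits.

Record cmor (B C : complex) := CMor {
  cm : forall i, {linear cobj B i -> cobj C i};
  cm_comm : forall i x, cm (i + 1) (cd B i x) = cd C i (cm i x)
}.

Definition comp_eq (A B C : complex) (g : cmor B C) (f : cmor A B) (h : cmor A C) :=
  forall i x, cm g i (cm f i x) = cm h i x.

Definition is_id (A : complex) (f : cmor A A) := forall i x, cm f i x = x.

Definition is_automorphism (A : complex) (h : cmor A A) :=
  exists k : cmor A A,
    (forall i x, cm k i (cm h i x) = x) /\ (forall i x, cm h i (cm k i x) = x).

Definition ses_cx (C Y D : complex) (f : cmor C Y) (g : cmor Y D) :=
  forall i, ses_mod (cm f i) (cm g i).

Definition X_complex (X : mclass) (D : complex) := forall i, X (cobj D i).

(** C is X-injective: Ext^1(D, C) = 0 for all X-complexes D, i.e. every short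
    exact sequence 0 -> C -> Y -> D -> 0 with D an X-complex splits. *)
Definition X_injective (X : mclass) (C : complex) :=
  forall (Y D : complex) (f : cmor C Y) (g : cmor Y D),
    X_complex X D -> ses_cx f g ->
    exists s : cmor D Y, forall i x, cm g i (cm s i x) = x.

Definition X_inj_envelope (X : mclass) (B T : complex) (phi : cmor B T) :=
  X_injective X T /\
  (forall (T' : complex) (f : cmor B T'), X_injective X T' ->
     exists g : cmor T T', comp_eq g phi f) /\
  (forall h : cmor T T, comp_eq h phi phi -> is_automorphism h).

End Defs.

(* Main.v *)
(** Embed [B] in an injective complex [J] and let [T] be maximal among the
    subcomplexes of [J] which are essential over [B] and whose quotient by [B] is
    an [X]-complex; [T] exists by Zorn's lemma, closure under direct limits
    providing the upper bounds of chains.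
    - [T] is [X]-injective: given [0 -> T -> Y -> D -> 0] with [D] an [X]-complex,
      pick [K] maximal among the subcomplexes of [Y] disjoint from [T].  Then [Y/K]
      is essential over [T], so that the inclusion of [T] extends to an embedding
      of [Y/K] in [J].  Closure under extensions and quotients makes its image
      another candidate, which is [T] by maximality: [T] is a retract of [Y].
    - A morphism from [B] to an [X]-injective complex extends to [T] because [T/B]
      is an [X]-complex (pushout).
    - An endomorphism [h] of [T] fixing [B] is injective by essentiality; [T/h(T)]
      is an [X]-complex, so [h(T)] has a complement in [T], and this complement is
      disjoint from [B], hence zero. *)
From HB Require Import structures.
Require Import Defs.
From mathcomp Require Import all_boot all_order all_algebra.
From mathcomp Require Import boolp.
From mathcomp Require classical_sets.
Set Implicit Arguments. Unset Strict Implicit. Unset Printing Implicit Defensive.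
Import GRing.Theory Num.Theory.
Local Open Scope ring_scope.
Local Open Scope quotient_scope.

(** Zorn's lemma is applied to the elements above [t0], where [t0] itself bounds the empty chain;
    hence only nonempty chains need a bound. A preorder suffices, so subcomplexes never have to be
    compared by equality. *)
Lemma zorn_above (T : Type) (le : T -> T -> Prop) (P : T -> Prop) (t0 : T) :
    (forall t, le t t) -> (forall s t u, le s t -> le t u -> le s u) -> P t0 ->
    (forall F : T -> Prop, (forall t, F t -> P t) -> (exists t, F t) ->
       (forall s t, F s -> F t -> le s t \/ le t s) ->
       exists2 t, P t & forall s, F s -> le s t) ->
  exists t, [/\ P t, le t0 t & forall s, P s -> le t s -> le s t].
Proof.
move=> lexx letr Pt0 chain.
pose U := {t : T | P t /\ le t0 t}.
pose r (s t : U) := `[<le (sval s) (sval t)>].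
have u0 : U by exists t0.
have [||A totA|t tmax] := @classical_sets.ZL_preorder U u0 r.
- by move=> t; apply/asboolP.
- by move=> s t u /asboolP st /asboolP tu; apply/asboolP; apply: letr tu.
- have [[a Aa]|A0] := pselect (exists a, A a); last first.
    by exists u0 => s As; case: A0; exists s.
  have [|||t Pt ub] := chain (fun t => exists2 u : U, A u & sval u = t).
  + by move=> _ [u _ <-]; case: (svalP u).
  + by exists (sval a), a.
  + move=> _ _ [u Au <-] [v Av <-].
    by have [/asboolP uv|/asboolP vu] := totA _ _ Au Av; [left|right].
  + have t0t : le t0 t 
      by apply: letr (ub (sval a) _); [case: (svalP a)|exists a].
    by exists (exist _ t (conj Pt t0t)) => s As; apply/asboolP/ub; exists s.
- case: t tmax => t [Pt t0t] tmax; exists t; split=> // s Ps ts.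
  have /asboolP := tmax (exist _ s (conj Ps (letr _ _ _ t0t ts))) (asboolT ts).
  exact.
Qed.

(** * Submodules and quotients *)

Section Submodules.
Variable R : pzRingType.
Implicit Types A B M N : lmodType R.

(** Since the graph is closed under linear combinations, single-valuedness need only be checked at
    0. Maps on quotients, retractions, sections and inverses are all obtained in this way from
    relations. *)
Lemma linear_of_graph A B (G : A -> B -> Prop) :
    (forall x, exists y, G x y) ->
    (forall a x x' y y', G x y -> G x' y' -> G (a *: x + x') (a *: y + y')) ->
    (forall y, G 0 y -> y = 0) ->
  {f : {linear A -> B} | forall x y, G x y <-> y = f x}.
Proof.
move=> tot lin fun0; pose f x := sval (cid (tot x)).
have Gf x : G x (f x) by rewrite /f; case: cid.
have GfE x y : G x y -> y = f x.
  move=> Gxy; have := lin (-1) _ _ _ _ Gxy (Gf x).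
  rewrite !scaleN1r addNr => /fun0 /eqP.
  by rewrite addrC subr_eq0 => /eqP.
have f_lin : linear f by move=> a x y; apply/esym/GfE/lin.
pose F : {linear A -> B} := HB.pack f (GRing.isLinear.Build _ _ _ _ f f_lin).
by exists F => x y; split=> [/GfE|->]; [|exact: Gf].
Qed.

(** Membership is a [Prop], so that images and unions of chains are plain formulas; [inmb] makes it
    boolean for subtypes and quotients. *)
Record submod M := Submod {
  inm :> M -> Prop;
  inm0 : inm 0;
  inmP : forall a x y, inm x -> inm y -> inm (a *: x + y)
}.

Section Theory.
Variables (M : lmodType R) (S : submod M).
Lemma inmD x y : S x -> S y -> S (x + y).
Proof. by move=> Sx Sy; rewrite -[x]scale1r; apply: inmP. Qed.
Lemma inmZ a x : S x -> S (a *: x).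
Proof. by move=> Sx; rewrite -[_ *: _]addr0; apply: inmP (inm0 S). Qed.

Definition inmb : pred M := fun x => `[<S x>].
Lemma inmb_closed : subsemimod_closed inmb.
Proof.
split; first split.
- exact/asboolP/inm0.
- by move=> x y /asboolP Sx /asboolP Sy; apply/asboolP/inmD.
- by move=> a x /asboolP Sx; apply/asboolP/inmZ.
Qed.
HB.instance Definition _ := GRing.isSubmodClosed.Build R M inmb inmb_closed.

Definition subm_sort := {x : M | x \in inmb}.
HB.instance Definition _ := SubChoice.on subm_sort.
HB.instance Definition _ := [SubChoice_isSubLmodule of subm_sort by <:].
Definition subm : lmodType R := subm_sort.

Definition submv : {linear subm -> M} := (val : subm_sort -> M).

Lemma submvP (x : subm) : S (submv x).
Proof. exact/asboolP/(svalP x). Qed.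
Lemma submv_onto x : S x -> exists y, submv y = x.
Proof. by move=> /asboolP Sx; exists (exist _ x Sx). Qed.
Lemma submv_inj : injective submv. Proof. exact: val_inj. Qed.

Definition quotm_sort := Quotient.quot (GRing.ZmodClosed.clone M inmb _).
HB.instance Definition _ := GRing.Zmodule.on quotm_sort.
Definition quot_pi (x : M) : quotm_sort := \pi_(quotm_sort) x.

Lemma quot_pi_onto y : exists x, quot_pi x = y.
Proof. by exists (repr y); apply: reprK. Qed.
Lemma quot_pi_eq x y : quot_pi x = quot_pi y <-> S (x - y).
Proof.
split=> [/eqP|Sxy].
  by rewrite -Quotient.idealrBE => /asboolP.
by apply/eqP; rewrite -Quotient.idealrBE; apply/asboolP.
Qed.
Lemma quot_piD x y : quot_pi (x + y) = quot_pi x + quot_pi y.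
Proof. by rewrite /quot_pi !piE. Qed.

(** A chosen representative is scaled; [quot_piZ] shows that the choice does not matter, and the
    module laws follow. *)
Definition quotm_scale (a : R) (x : quotm_sort) : quotm_sort :=
  quot_pi (a *: sval (cid (quot_pi_onto x))).

Lemma quot_piZ a x : quot_pi (a *: x) = quotm_scale a (quot_pi x).
Proof.
rewrite /quotm_scale; case: cid => y /= /quot_pi_eq yx; apply/esym/quot_pi_eq.
by rewrite -scalerBr; apply: inmZ.
Qed.
Lemma quotm_scaleA a b v : quotm_scale a (quotm_scale b v) = quotm_scale (a * b) v.
Proof. by have [x <-] := quot_pi_onto v; rewrite -!quot_piZ scalerA. Qed.
Lemma quotm_scale1 : left_id 1 quotm_scale.
Proof. by move=> v; have [x <-] := quot_pi_onto v; rewrite -quot_piZ scale1r. Qed.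
Lemma quotm_scaleDr : right_distributive quotm_scale +%R.
Proof.
move=> a u v; have [[x <-] [y <-]] := (quot_pi_onto u, quot_pi_onto v).
by rewrite -quot_piD -!quot_piZ scalerDr quot_piD.
Qed.
Lemma quotm_scaleDl v : {morph quotm_scale^~ v: a b / a + b}.
Proof. by move=> a b; have [x <-] := quot_pi_onto v; rewrite -!quot_piZ scalerDl quot_piD. Qed.
HB.instance Definition _ := GRing.Zmodule_isLmodule.Build R quotm_sort
  quotm_scaleA quotm_scale1 quotm_scaleDr quotm_scaleDl.
Definition quotm : lmodType R := quotm_sort.

Lemma quot_pi_linear : linear quot_pi.
Proof. by move=> a x y; rewrite quot_piD quot_piZ. Qed.
HB.instance Definition _ := GRing.isLinear.Build R M quotm_sort _ quot_pi quot_pi_linear.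
Definition qpi : {linear M -> quotm} := quot_pi.
Lemma qpi_onto (y : quotm) : exists x, qpi x = y.
Proof. exact: quot_pi_onto. Qed.

Lemma qpi_eq0 x : qpi x = 0 <-> S x.
Proof. by rewrite -(linear0 qpi) quot_pi_eq subr0. Qed.
End Theory.
End Submodules.
Arguments submv {R M S}.
Arguments submv_inj {R M S}.
Arguments submvP {R M S}.
Arguments submv_onto {R M S} [x].
Arguments qpi_onto {R M S}.
Arguments qpi_eq0 {R M S}.

Section SubmodOperations.
Variable R : pzRingType.
Implicit Types A M N : lmodType R.

Definition topm M : submod M := @Submod _ _ (fun=> True) I (fun _ _ _ _ _ => I).

Lemma zerom_proof M a (x y : M) : x = 0 -> y = 0 -> a *: x + y = 0.
Proof. by move=> -> ->; rewrite scaler0 addr0. Qed.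
Definition zerom M : submod M := @Submod _ M (fun x => x = 0) erefl (@zerom_proof M).

Lemma imm_proof M N (g : {linear M -> N}) (S : submod M) a y y' :
  (exists2 x, S x & g x = y) -> (exists2 x, S x & g x = y') ->
  exists2 x, S x & g x = a *: y + y'.
Proof.
move=> [x Sx <-] [x' Sx' <-]; exists (a *: x + x'); first exact: inmP.
by rewrite linearP.
Qed.
Definition imm M N (g : {linear M -> N}) (S : submod M) : submod N :=
  Submod (ex_intro2 _ _ 0 (inm0 S) (linear0 g)) (@imm_proof M N g S).

Lemma prem_proof0 M N (g : {linear M -> N}) (S : submod N) : S (g 0).
Proof. by rewrite linear0; apply: inm0. Qed.
Lemma prem_proof M N (g : {linear M -> N}) (S : submod N) a x y :
  S (g x) -> S (g y) -> S (g (a *: x + y)).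
Proof. by rewrite linearP; apply: inmP. Qed.
Definition prem M N (g : {linear M -> N}) (S : submod N) : submod M :=
  Submod (prem_proof0 g S) (@prem_proof M N g S).

Lemma capm_proof M (S S' : submod M) a x y :
  S x /\ S' x -> S y /\ S' y -> S (a *: x + y) /\ S' (a *: x + y).
Proof. by move=> [? ?] [? ?]; split; apply: inmP. Qed.
Definition capm M (S S' : submod M) : submod M :=
  Submod (conj (inm0 S) (inm0 S')) (@capm_proof M S S').

Lemma subm_lift A M (S : submod M) (f : {linear A -> M}) : (forall x, S (f x)) ->
  {f' : {linear A -> subm S} | forall x, submv (f' x) = f x}.
Proof.
move=> Sf; have [|||f' f'P] := @linear_of_graph R A (subm S) (fun x y => submv y = f x).
- by move=> x; apply: submv_onto.
- by move=> a x x' y y' yx yx'; rewrite !linearP yx yx'.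
- by move=> y; rewrite linear0 => y0; apply: submv_inj; rewrite y0 linear0.
by exists f' => x; apply/f'P.
Qed.
Definition subm_map M (S S' : submod M) (SS' : forall x, S x -> S' x) :
  {linear subm S -> subm S'} := sval (subm_lift (fun x => SS' _ (submvP x))).
Lemma subm_mapE M (S S' : submod M) SS' x :
  submv (@subm_map M S S' SS' x) = submv x.
Proof. exact: (svalP (subm_lift _)). Qed.

(** [U] is the direct limit of the members of the chain, indexed by the chain itself with the
    inclusions as maps. *)
Lemma chain_union_mclass (X : mclass R) M (F : submod M -> Prop) (U : submod M) :
    closed_dirlim X -> (exists S, F S) ->
    (forall S S', F S -> F S' ->
      (forall x, S x -> S' x) \/ (forall x, S' x -> S x)) ->
    (forall x, U x <-> exists2 S, F S & S x) ->
    (forall S, F S -> X (subm S)) ->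
  X (subm U).
Proof.
move=> Xlim [S0 FS0] chain UE FX.
pose I := {S | F S}.
pose le (S S' : I) := forall x, sval S x -> sval S' x.
have lemap (S S' : I) x h : submv (@subm_map _ (sval S) (sval S') h x) = submv x.
  exact: subm_mapE.
unshelve refine (let D := @DirSystem R I le _ _ _ _
  (fun S : I => subm (sval S)) (fun S S' h => subm_map h) _ _ in _).
- by move=> S x.
- by move=> S S' S'' h h' x /h /h'.
- by exists (exist _ S0 FS0).
- move=> S S'; have [h|h] := chain _ _ (svalP S) (svalP S').
    by exists S'; split.
  by exists S; split.
- by move=> S h x; apply: submv_inj; rewrite lemap.
- by move=> S S' S'' h h' h'' x; apply: submv_inj; rewrite !lemap.
have SU (S : I) x : sval S x -> U x by move=> Sx; apply/UE; exists (sval S); [exact: svalP|].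
have onto (y : subm U) : exists S : I, exists x : subm (sval S), subm_map (@SU S) x = y.
  have /UE[S FS Sy] := submvP y; exists (exist _ S FS).
  have [x xy] := submv_onto Sy; exists x; apply: submv_inj.
  by rewrite subm_mapE.
apply: (Xlim D (subm U) (fun S => subm_map (@SU S))); first by move=> S; apply/FX/svalP.
split=> [S S' h x|N v vc]; first by apply: submv_inj; rewrite !subm_mapE.
split; last first.
  by move=> t1 t2 t1v t2v y; have [S [x <-]] := onto y; rewrite t1v t2v.
have lift (S S' : I) (h : le S S') (x : subm (sval S)) (x' : subm (sval S')) :
    submv x = submv x' -> v S x = v S' x'.
  move=> xx'; rewrite -(vc S S' h); congr (v S' _); apply: submv_inj.
  by rewrite lemap.
have wd (S S' : I) (x : subm (sval S)) (x' : subm (sval S')) :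
    submv x = submv x' -> v S x = v S' x'.
  move=> xx'; have [h|h] := chain _ _ (svalP S) (svalP S'); first exact: lift.
  by apply/esym/lift.
(* The induced map sends an element of [U] to the value of [v] on a lift to any member of the chain;
   by [wd] the member does not matter. *)
have [|||t tP] := @linear_of_graph R (subm U) N (fun x y =>
  exists S : I, exists2 z : subm (sval S), submv z = submv x & y = v S z).
- move=> y; have [S [x <-]] := onto y; exists (v S x), S, x => //.
  by rewrite subm_mapE.
- move=> a x x' y y' [S [z zx ->]] [S' [z' zx' ->]].
  have [h|h] := chain _ _ (svalP S) (svalP S').
    exists S', (a *: subm_map h z + z'); rewrite !linearP ?subm_mapE ?zx ?zx' //.
    congr (_ *: _ + _); apply: wd; exact/esym/lemap.
  exists S, (a *: z + subm_map h z'); rewrite !linearP ?subm_mapE ?zx ?zx' //.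
  congr (_ *: _ + _); apply: wd; exact/esym/lemap.
- move=> y [S [z z0 ->]]; suff -> : z = 0 by rewrite linear0.
  by apply: submv_inj; rewrite z0 !linear0.
exists t => S x; apply/esym/tP; exists S, x => //.
by rewrite subm_mapE.
Qed.

End SubmodOperations.

(** * Subcomplexes *)

Section Subcomplexes.
Variable R : pzRingType.
Implicit Types A B C : complex R.

Lemma cmor_of_graph A B (G : forall i, cobj A i -> cobj B i -> Prop) :
    (forall i x, exists y, G i x y) ->
    (forall i a x x' y y', G i x y -> G i x' y' -> G i (a *: x + x') (a *: y + y')) ->
    (forall i y, G i 0 y -> y = 0) ->
    (forall i x y, G i x y -> G (i + 1) (cd A i x) (cd B i y)) ->
  exists f : cmor A B, forall i x y, G i x y <-> y = cm f i x.
Proof.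
move=> tot lin fun0 comm.
pose f i := linear_of_graph (tot i) (lin i) (fun0 i).
unshelve refine (let F := @CMor _ A B (fun i => sval (f i)) _ in _).
  by move=> i x; apply/esym/(svalP (f (i + 1)))/comm/(svalP (f i)).
by exists F => i; apply: (svalP (f i)).
Qed.

Record subcx C := Subcx {
  scm :> forall i, submod (cobj C i);
  scd : forall i x, scm i x -> scm (i + 1) (cd C i x)
}.

Definition sle C (S S' : subcx C) := forall i x, S i x -> S' i x.

Lemma sle_refl C (S : subcx C) : sle S S. Proof. by []. Qed.
Lemma sle_trans C (S S' S'' : subcx C) : sle S S' -> sle S' S'' -> sle S S''.
Proof. by move=> h h' i x /h /h'. Qed.

Section Composition.
Variables (A B C : complex R) (g : cmor B C) (f : cmor A B).
Lemma ccomp_comm i x : (cm g (i + 1) \o cm f (i + 1)) (cd A i x) = cd C i ((cm g i \o cm f i) x).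
Proof. by rewrite /= !cm_comm. Qed.
Definition ccomp : cmor A C := CMor ccomp_comm.
End Composition.

Section SubQuotient.
Variables (C : complex R) (S : subcx C).

Lemma subC_d_proof i : {f : {linear subm (S i) -> subm (S (i + 1))} |
  forall x y, submv y = cd C i (submv x) <-> y = f x}.
Proof.
apply: linear_of_graph => [x|a x x' y y' yx yx'|y].
- by apply/submv_onto/scd/submvP.
- by rewrite !linearP yx yx'.
- by rewrite !linear0 => y0; apply: submv_inj; rewrite y0 linear0.
Qed.
Definition subC_d i := sval (subC_d_proof i).
Lemma subC_dE i x : submv (subC_d i x) = cd C i (submv x).
Proof. exact/(svalP (subC_d_proof i)). Qed.
Lemma subC_dd i x : subC_d (i + 1) (subC_d i x) = 0.
Proof. by apply: submv_inj; rewrite !subC_dE linear0 cdd. Qed.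
Definition subC : complex R := Complex subC_dd.
Definition incl : cmor subC C := @CMor _ subC C (fun i => @submv _ _ (S i)) subC_dE.

Lemma quoC_d_proof i : {f : {linear quotm (S i) -> quotm (S (i + 1))} |
  forall x y, (exists2 z, x = qpi (S i) z & y = qpi (S (i + 1)) (cd C i z)) <-> y = f x}.
Proof.
apply: linear_of_graph => [x|a x x' y y' [z -> ->] [z' -> ->]|y [z /esym z0 ->]].
- by have [z <-] := qpi_onto x; exists (qpi (S (i + 1)) (cd C i z)), z.
- by exists (a *: z + z'); rewrite !linearP.
- by apply/qpi_eq0/scd/qpi_eq0.
Qed.
Definition quoC_d i := sval (quoC_d_proof i).
Lemma quoC_dE i x : quoC_d i (qpi (S i) x) = qpi (S (i + 1)) (cd C i x).
Proof. by apply/esym/(svalP (quoC_d_proof i)); exists x. Qed.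
Lemma quoC_dd i x : quoC_d (i + 1) (quoC_d i x) = 0.
Proof. by have [z <-] := qpi_onto x; rewrite !quoC_dE cdd linear0. Qed.
Definition quoC : complex R := Complex quoC_dd.
Definition proj : cmor C quoC :=
  @CMor _ C quoC (fun i => qpi (S i)) (fun i x => esym (quoC_dE x)).
End SubQuotient.

Definition topcx C : subcx C := @Subcx C (fun i => topm (cobj C i)) (fun _ _ _ => I).

Lemma imcx_proof A C (f : cmor A C) (S : subcx A) i x :
  imm (cm f i) (S i) x -> imm (cm f (i + 1)) (S (i + 1)) (cd C i x).
Proof.
by move=> [y Sy <-]; exists (cd A i y); [exact: scd | exact: cm_comm].
Qed.
Definition imcx A C (f : cmor A C) (S : subcx A) : subcx C := Subcx (@imcx_proof A C f S).

Lemma precx_proof A C (f : cmor A C) (S : subcx C) i x :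
  prem (cm f i) (S i) x -> prem (cm f (i + 1)) (S (i + 1)) (cd A i x).
Proof. by rewrite /= cm_comm; apply: scd. Qed.
Definition precx A C (f : cmor A C) (S : subcx C) : subcx A := Subcx (@precx_proof A C f S).

Lemma capcx_proof C (S S' : subcx C) i x :
  capm (S i) (S' i) x -> capm (S (i + 1)) (S' (i + 1)) (cd C i x).
Proof. by move=> [? ?]; split; apply: scd. Qed.
Definition capcx C (S S' : subcx C) : subcx C := Subcx (@capcx_proof C S S').

Lemma chain_union C (F : subcx C -> Prop) :
    (exists S, F S) -> (forall S S', F S -> F S' -> sle S S' \/ sle S' S) ->
  exists U : subcx C, forall i x, U i x <-> exists2 S, F S & S i x.
Proof.
move=> [S0 FS0] chain.
pose P i x := exists2 S, F S & scm S i x.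
have P0 i : P i 0 by exists S0 => //; apply: inm0.
have PP i a x y : P i x -> P i y -> P i (a *: x + y).
  move=> [S FS Sx] [S' FS' Sy]; have [h|h] := chain _ _ FS FS'.
    by exists S' => //; apply: inmP => //; apply: h.
  by exists S => //; apply: inmP => //; apply: h.
unshelve refine (let U := @Subcx C (fun i => Submod (P0 i) (PP i)) _ in _).
  by move=> i x [S FS Sx]; exists S => //; apply: scd.
by exists U.
Qed.

Lemma subC_lift A C (S : subcx C) (f : cmor A C) : (forall i x, S i (cm f i x)) ->
  exists f' : cmor A (subC S), forall i x, submv (cm f' i x) = cm f i x.
Proof.
move=> Sf; pose f' i := subm_lift (Sf i).
unshelve refine (let F := @CMor _ A (subC S) (fun i => sval (f' i)) _ in _).
  by move=> i x; apply: submv_inj; rewrite (svalP (f' _)) [RHS]subC_dE (svalP (f' _)) cm_comm.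
by exists F => i; apply: (svalP (f' i)).
Qed.

Lemma zerocx_proof C i x : zerom _ x -> zerom _ (cd C i x).
Proof. by move=> /= ->; rewrite linear0. Qed.
Definition zerocx C : subcx C := Subcx (@zerocx_proof C).

Definition disjointcx C (S S' : subcx C) := forall i x, S i x -> S' i x -> x = 0.

(* This does not require [S'] to be contained in [S]. *)
Definition essential C (S S' : subcx C) :=
  forall K, sle K S -> disjointcx K S' -> forall i x, K i x -> x = 0.

Lemma maximal_disjoint C (S : subcx C) :
  exists K, disjointcx K S /\ forall K', disjointcx K' S -> sle K K' -> sle K' K.
Proof.
have [||||K [dK _ maxK]] := @zorn_above _ (@sle C) (fun K => disjointcx K S) (zerocx C).
- exact: sle_refl.
- exact: sle_trans.
- by move=> i x /= ->.
- move=> F FP F0 /(chain_union F0)[U UE]; exists U; last first.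
    by move=> K FK i x Kx; apply/UE; exists K.
  by move=> i x /UE[K /FP dK Kx]; apply: dK.
by exists K.
Qed.

(** If a subcomplex of the quotient meets the image of [S] trivially, its preimage contains [K] and
    is disjoint from [S], so it is [K] by maximality. *)
Lemma essential_quotient C (S K : subcx C) : disjointcx K S ->
    (forall K', disjointcx K' S -> sle K K' -> sle K' K) ->
  essential (topcx (quoC K)) (imcx (proj K) S).
Proof.
move=> dK maxK L _ dL i y Ly; have [x xy] := qpi_onto y.
rewrite -xy; apply/qpi_eq0/(maxK (precx (proj K) L)) => [j z Lz Sz|j z Kz|].
- apply: (dK j) => //; apply/qpi_eq0/(dL j) => //.
  by exists z.
- by rewrite /= (_ : qpi _ _ = 0); [apply: inm0|apply/qpi_eq0].
- by rewrite /= xy.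
Qed.

End Subcomplexes.

(** * Injective modules and complexes *)

(** The generator is the least positive element, or 0 if there is none. In the uses below it is the
    order of an element, absolutely or modulo the domain of a partial map. *)
Lemma int_subgroup_principal (H : int -> Prop) :
    H 0 -> (forall m n, H m -> H n -> H (m - n)) ->
  exists m : nat, forall n, H n <-> exists k, n = m%:Z * k.
Proof.
move=> H0 HB.
have HN n : H n -> H (- n) by move=> /(HB _ _ H0); rewrite sub0r.
have HD m n : H m -> H n -> H (m + n) by move=> Hm /HN /(HB _ _ Hm); rewrite opprK.
have HMn m (n : nat) : H m -> H (m * n%:Z).
  move=> Hm; elim: n => [|n IHn]; first by rewrite mulr0.
  by rewrite intS mulrDr mulr1; apply: HD.
have HM m n : H m -> H (m * n).
  by case: n => n Hm; [|rewrite NegzE mulrN; apply/HN]; apply: HMn.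
have [Hpos|Hneg] := pselect (exists m : nat, `[< H m.+1%:Z >]).
- case: (ex_minnP Hpos) => m /asboolP Hm min_m.
  exists m.+1 => n; split=> [Hn|[k ->]]; last exact: HM.
  exists (n %/ m.+1%:Z)%Z; rewrite mulrC {1}(divz_eq n m.+1%:Z).
  suff -> : (n %% m.+1%:Z)%Z = 0 by rewrite addr0.
  have Hr : H (n %% m.+1%:Z)%Z.
    have -> : (n %% m.+1%:Z)%Z = n - m.+1%:Z * (n %/ m.+1%:Z)%Z.
      by rewrite {2}(divz_eq n m.+1%:Z) mulrC addrC addrA addNr add0r.
    by apply/HB/HM.
  have := ltz_mod n (isT : m.+1%:Z != 0); have := modz_ge0 n (isT : m.+1%:Z != 0).
  case: (n %% m.+1%:Z)%Z Hr => // -[//|r] Hr _.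
  rewrite ltz_nat ltnS ltnNge => /negP[].
  exact/min_m/asboolP.
- exists 0%N => n; split=> [|[k ->]]; last by rewrite mul0r.
  case: n => [[|n]|n] Hn; first by exists 0.
    by case: Hneg; exists n; apply/asboolP.
  by case: Hneg; exists n; apply/asboolP; rewrite -[_%:Z]opprK -NegzE; apply: HN.
Qed.

Definition int_rat : pred rat := fun x => x \is a Num.int.
Lemma int_rat_closed : zmod_closed int_rat.
Proof. by split=> [|x y]; [apply: rpred0 | apply: rpredB]. Qed.
HB.instance Definition _ := GRing.isZmodClosed.Build rat int_rat int_rat_closed.

(** [D] is Q/Z and [c] is the class of 1/m. For m = 0, which later encodes infinite order, any
    nonzero class will do, and that of 1/2 is taken. *)
Lemma QmodZ_exists : exists D : zmodType,
  (forall (n : nat) (y : D), exists z, z *+ n.+1 = y) /\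
  (forall m : nat, m != 1%N -> exists c : D, c <> 0 /\ c *+ m = 0).
Proof.
pose D : zmodType := Quotient.quot (GRing.ZmodClosed.clone rat int_rat _).
pose p (x : rat) : D := \pi_D x.
have pD x y : p (x + y) = p x + p y by rewrite /p !piE.
have p_eq0 x : (p x == 0) = (x \is a Num.int).
  have <- : p 0 = 0 by rewrite /p piE.
  by rewrite -Quotient.idealrBE subr0.
have pMn x n : p (x *+ n) = p x *+ n.
  elim: n => [|n IHn]; first by apply/eqP; rewrite !mulr0n p_eq0.
  by rewrite !mulrS pD IHn.
have pV n : p n.+2%:R^-1 <> 0.
  move/eqP; rewrite p_eq0 => /norm_intr_ge1.
  rewrite invr_eq0 pnatr_eq0 => /(_ isT).
  rewrite normfV normr_nat.
  by rewrite invf_ge1 ?ltr0n // (ler_nat _ _ 1).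
exists D; split=> [n y|m m1].
  exists (p (repr y / n.+1%:R)).
  by rewrite -pMn -[_ *+ n.+1]mulr_natr divfK ?pnatr_eq0 // /p reprK.
case: m m1 => [_|[//|m] _]; first by exists (p 2%:R^-1).
exists (p m.+2%:R^-1); split=> //.
by apply/eqP; rewrite -pMn p_eq0 -[_ *+ _]mulr_natr mulVf ?pnatr_eq0.
Qed.

(** * Extension of additive maps into divisible groups *)

Section DivisibleExtension.
Variables (B D : zmodType).
Hypothesis divD : forall (n : nat) (y : D), exists z, z *+ n.+1 = y.

(** These are the homomorphisms defined on a subgroup of [B]. As relations they are ordered by
    inclusion, and a nonempty chain is bounded by its union. *)
Definition additive_graph (G : B -> D -> Prop) :=
  [/\ G 0 0, forall x y x' y', G x y -> G x' y' -> G (x - x') (y - y')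
    & forall y, G 0 y -> y = 0].

Lemma additive_graphD G : additive_graph G ->
  forall x y x' y', G x y -> G x' y' -> G (x + x') (y + y').
Proof.
move=> [G0 GB _] x y x' y' Gxy /(GB _ _ _ _ G0); rewrite !sub0r => /(GB _ _ _ _ Gxy).
by rewrite !opprK.
Qed.

Lemma additive_graphMz G : additive_graph G ->
  forall x y (n : int), G x y -> G (x *~ n) (y *~ n).
Proof.
move=> gG x y n Gxy; have GMn (m : nat) : G (x *+ m) (y *+ m).
  elim: m => [|m IHm]; first by case: gG.
  by rewrite !mulrS; apply: additive_graphD.
case: gG => G0 GB _; case: n => n; first exact: GMn.
rewrite NegzE !mulrNz -[- (x *~ _)]sub0r -[- (y *~ _)]sub0r.
by apply: GB => //; apply: GMn.
Qed.

(** The multiples of [x] in the domain of [G] are those of m x for some m. Divisibility gives [c]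
    with m c equal to the value at m x, and then [x] can be sent to [c]. *)
Lemma additive_graph_adjoin G x : additive_graph G ->
  exists G', [/\ additive_graph G', forall u v, G u v -> G' u v & exists c, G' x c].
Proof.
move=> gG; case: (gG) => G0 GB Gfun; have GD := additive_graphD gG.
have [||m mP] := @int_subgroup_principal (fun n => exists y, G (x *~ n) y).
- by exists 0.
- by move=> m n [y Gy] [z Gz]; exists (y - z); rewrite mulrzBr; apply: GB.
have [c Gc] : exists c, G (x *~ m) (c *~ m).
  case: m mP => [|m] mP; first by exists 0.
  have /mP[y Gy] : exists k, m.+1%:Z = m.+1%:Z * k by exists 1; rewrite mulr1.
  by have [c cy] := divD m y; exists c; rewrite -[c *~ _]/(c *+ m.+1) cy.
exists (fun u v => exists n u0 v0, [/\ G u0 v0, u = u0 + x *~ n & v = v0 + c *~ n]).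
split; last by exists c, 1, 0, 0; rewrite !add0r.
- split; first by exists 0, 0, 0; rewrite !addr0.
    move=> _ _ _ _ [n [u [v [Guv -> ->]]]] [n' [u' [v' [Guv' -> ->]]]].
    exists (n - n'), (u - u'), (v - v'); rewrite !mulrzBr; split; first exact: GB.
      by rewrite opprD addrACA.
    by rewrite opprD addrACA.
  (* If u + n x = 0, then n x lies in the domain of [G], so n = m k, and v + n c is the value of [G]
     at u + k (m x) = 0. *)
  move=> _ [n [u [v [Guv /esym/eqP + ->]]]]; rewrite addr_eq0 => /eqP uE.
  have [k nE] : exists k, n = m%:Z * k.
    by apply/mP; exists (- v); rewrite -[x *~ n]opprK -uE -[- u]sub0r -[- v]sub0r; apply: GB.
  apply: Gfun; have := GD _ _ _ _ Guv (additive_graphMz gG k Gc).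
    by rewrite -!mulrzA -nE uE addNr.
- by move=> u v Guv; exists 0, u, v; rewrite !addr0.
Qed.

Lemma extend_additive_graph G : additive_graph G ->
  exists v : {additive B -> D}, forall x y, G x y -> y = v x.
Proof.
move=> gG.
have [||||F [gF GF maxF]] := @zorn_above _ (fun G G' => forall x y, G x y -> G' x y)
    additive_graph G; rewrite //.
- by move=> G1 G2 G3 h h' x y /h /h'.
- move=> F gF [F0 FF0] chain; exists (fun x y => exists2 G, F G & G x y); last first.
    by move=> G1 FG1 x y G1xy; exists G1.
  split.
  + by exists F0 => //; case: (gF _ FF0).
  + move=> x y x' y' [G1 FG1 h1] [G2 FG2 h2].
    have [h|h] := chain _ _ FG1 FG2.
      by exists G2 => //; case: (gF _ FG2) => _ + _; apply=> //; apply: h.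
    by exists G1 => //; case: (gF _ FG1) => _ + _; apply=> //; apply: h.
  + by move=> y [G1 FG1]; case: (gF _ FG1) => _ _; apply.
have totF x : exists y, F x y.
  have [F' [gF' FF' [c F'xc]]] := additive_graph_adjoin x gF.
  by exists c; apply: (maxF F').
case: gF => _ FB Ffun.
pose v x := sval (cid (totF x)).
have Fv x : F x (v x) by rewrite /v; case: cid.
have FvE x y : F x y -> y = v x.
  by move=> Fxy; have := FB _ _ _ _ Fxy (Fv x); rewrite subrr => /Ffun/subr0_eq.
have v_additive : zmod_morphism v by move=> x y; apply/esym/FvE/FB.
pose V : {additive B -> D} := HB.pack v (GRing.isZmodMorphism.Build _ _ v v_additive).
by exists V => x y /GF; apply: FvE.
Qed.
End DivisibleExtension.

(** * Coinduced modules *)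

Section Coinduced.
Variables (R : pzRingType) (S : Type) (D : zmodType).

(* With [R] acting by right translation of the argument, a linear map into this
   module is the same thing as an [S]-indexed family of additive maps into [D]. *)
Definition coind_sort :=
  {p : S -> R -> D | forall s a b, p s (a + b) = p s a + p s b}.
HB.instance Definition _ := gen_eqMixin coind_sort.
HB.instance Definition _ := gen_choiceMixin coind_sort.

Lemma coind_eq (p q : coind_sort) : (forall s a, sval p s a = sval q s a) -> p = q.
Proof.
case: p q => [p Hp] [q Hq] /= pq; apply: eq_exist.
by apply: funext => s; apply: funext => a; apply: pq.
Qed.

Lemma coind_zero_proof (s : S) (a b : R) : 0 = 0 + 0 :> D. Proof. by rewrite addr0. Qed.
Definition coind_zero : coind_sort :=
  exist _ (fun _ _ => 0) coind_zero_proof.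
Lemma coind_opp_proof (p : coind_sort) s a b :
  - sval p s (a + b) = - sval p s a - sval p s b.
Proof. by rewrite (svalP p) opprD. Qed.
Definition coind_opp (p : coind_sort) : coind_sort :=
  exist _ (fun s a => - sval p s a) (coind_opp_proof p).
Lemma coind_add_proof (p q : coind_sort) s a b :
  sval p s (a + b) + sval q s (a + b) = sval p s a + sval q s a + (sval p s b + sval q s b).
Proof. by rewrite (svalP p) (svalP q) addrACA. Qed.
Definition coind_add (p q : coind_sort) : coind_sort :=
  exist _ (fun s a => sval p s a + sval q s a) (coind_add_proof p q).
Lemma coind_scale_proof r (p : coind_sort) s a b :
  sval p s ((a + b) * r) = sval p s (a * r) + sval p s (b * r).
Proof. by rewrite mulrDl (svalP p). Qed.
Definition coind_scale r (p : coind_sort) : coind_sort :=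
  exist _ (fun s a => sval p s (a * r)) (coind_scale_proof r p).

Lemma coind_addA : associative coind_add.
Proof. by move=> p q r; apply: coind_eq => s a; apply: addrA. Qed.
Lemma coind_addC : commutative coind_add.
Proof. by move=> p q; apply: coind_eq => s a; apply: addrC. Qed.
Lemma coind_add0 : left_id coind_zero coind_add.
Proof. by move=> p; apply: coind_eq => s a; apply: add0r. Qed.
Lemma coind_addN : left_inverse coind_zero coind_opp coind_add.
Proof. by move=> p; apply: coind_eq => s a; apply: addNr. Qed.
HB.instance Definition _ := GRing.isZmodule.Build coind_sort
  coind_addA coind_addC coind_add0 coind_addN.

Lemma coind_scaleA a b v : coind_scale a (coind_scale b v) = coind_scale (a * b) v.
Proof. by apply: coind_eq => s x /=; rewrite mulrA. Qed.
Lemma coind_scale1 : left_id 1 coind_scale.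
Proof. by move=> v; apply: coind_eq => s x /=; rewrite mulr1. Qed.
Lemma coind_scaleDr : right_distributive coind_scale +%R.
Proof. by move=> a u v; apply: coind_eq. Qed.
Lemma coind_scaleDl v : {morph coind_scale^~ v: a b / a + b}.
Proof. by move=> a b; apply: coind_eq => s x /=; rewrite mulrDr (svalP v). Qed.
HB.instance Definition _ := GRing.Zmodule_isLmodule.Build R coind_sort
  coind_scaleA coind_scale1 coind_scaleDr coind_scaleDl.
Definition coind : lmodType R := coind_sort.

Lemma coind_transpose_proof (B : lmodType R) (c : S -> {additive B -> D}) b s (x y : R) :
  c s ((x + y) *: b) = c s (x *: b) + c s (y *: b).
Proof. by rewrite scalerDl raddfD. Qed.
Definition coind_transpose_fun (B : lmodType R) (c : S -> {additive B -> D}) (b : B) :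
  coind_sort := exist _ (fun s x => c s (x *: b)) (coind_transpose_proof c b).
Lemma coind_transpose_linear B c : linear (@coind_transpose_fun B c).
Proof.
by move=> a x y; apply: coind_eq => s r /=; rewrite scalerDr raddfD scalerA.
Qed.
Definition coind_transpose (B : lmodType R) (c : S -> {additive B -> D}) :
  {linear B -> coind} := HB.pack (@coind_transpose_fun B c)
    (GRing.isLinear.Build _ _ _ _ _ (coind_transpose_linear c)).
End Coinduced.

(** * Enough injective modules *)

Section Injectives.
Variable R : pzRingType.
Implicit Types A B M E : lmodType R.

Definition injective_module E :=
  forall A B (f : {linear A -> B}) (u : {linear A -> E}), injective f ->
  exists v : {linear B -> E}, forall x, v (f x) = u x.

(** Evaluating at 1 turns [u] into a family of additive maps. Each extends along [f] by
    divisibility, and the transpose of the extended family extends [u], because the value of [u x]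
    at [a] is that of [u (a *: x)] at 1. *)
Lemma coind_injective S (D : zmodType) :
    (forall (n : nat) (y : D), exists z, z *+ n.+1 = y) ->
  injective_module (coind R S D).
Proof.
move=> divD A B f u f_inj.
have f0 x : f x = 0 -> x = 0 by rewrite -(linear0 f) => /f_inj.
have /choice[c cP] : forall s : S, exists c : {additive B -> D},
    forall x, c (f x) = sval (u x) s 1.
  move=> s; have [|c cP] := @extend_additive_graph B D divD
      (fun b d => exists2 x, f x = b & d = sval (u x) s 1).
    split=> [|_ _ _ _ [x <- ->] [x' <- ->]|_ [x /f0 -> ->]].
    - by exists 0; rewrite !linear0.
    - by exists (x - x'); rewrite linearB // linearB.
    - by rewrite linear0.
  by exists c => x; apply/esym/cP; exists x.
exists (coind_transpose c) => x; apply: coind_eq => s a /=.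
by rewrite -linearZ cP linearZ /= mul1r.
Qed.

(** [M] is embedded by all its characters into Q/Z. They separate points: if [x] is nonzero of order
    m, sending [x] to a nonzero element killed by m defines a character on the multiples of [x],
    which extends to [M]. *)
Lemma enough_injective_modules M :
  exists E (j : {linear M -> E}), injective_module E /\ injective j.
Proof.
have [D [divD torD]] := QmodZ_exists.
exists (coind R {additive M -> D} D), (coind_transpose id).
split; first exact: coind_injective.
apply: raddf_inj => x /(congr1 (fun p => sval p)) jx0.
apply: contrapT => x0.
have [||m mP] := @int_subgroup_principal (fun n => x *~ n = 0).
- by rewrite mulr0z.
- by move=> m n mx nx; rewrite mulrzBr mx nx subr0.
have [|c [c0 cm]] := torD m.
  apply/eqP => m1; apply: x0; rewrite -[x]mulr1z; apply/mP.
  by exists 1; rewrite m1.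
have [|v vP] := @extend_additive_graph M D divD (fun y d => exists2 n, y = x *~ n & d = c *~ n).
  split=> [|_ _ _ _ [n -> ->] [n' -> ->]|_ [n /esym/mP[k ->] ->]].
  - by exists 0; rewrite !mulr0z.
  - by exists (n - n'); rewrite mulrzBr.
  - by rewrite mulrzA -[c *~ _]/(c *+ m) cm mul0rz.
apply: c0; have -> : c = v (1 *: x) by rewrite scale1r; apply: vP; exists 1; rewrite mulr1z.
by have := congr1 (fun p => p v 1) jx0.
Qed.

End Injectives.

(** * Enough injective complexes *)

Section InjectiveComplexes.
Variable R : pzRingType.
Implicit Types A B C J : complex R.

Definition injective_complex J :=
  forall A C (f : cmor A C) (u : cmor A J), (forall i, injective (cm f i)) ->
  exists v : cmor C J, comp_eq v f u.

(* The product over [i] of the disk complexes [I i = I i] in degrees [i - 1], [i]. *)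
Section Disk.
Variable I : int -> lmodType R.
Definition disk_obj i : lmodType R := (I i * I (i + 1))%type.
Definition disk_dfun i (x : disk_obj i) : disk_obj (i + 1) := (x.2, 0).
Lemma disk_d_linear i : linear (@disk_dfun i).
Proof.
by move=> a x y; rewrite /disk_dfun [RHS]surjective_pairing /= scaler0 addr0.
Qed.
HB.instance Definition _ i := GRing.isLinear.Build R (disk_obj i) (disk_obj (i + 1))
  _ (@disk_dfun i) (@disk_d_linear i).
Definition disk_d i : {linear disk_obj i -> disk_obj (i + 1)} := @disk_dfun i.
Lemma disk_dd i x : disk_d (i + 1) (disk_d i x) = 0. Proof. by []. Qed.
Definition disk : complex R := Complex disk_dd.

Section Cofree.
Variables (C : complex R) (q : forall i, {linear cobj C i -> I i}).
(** The first components of a morphism into [disk] are arbitrary linear maps, and commuting with the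
    differentials forces the second ones. Extending morphisms into [disk] thus reduces to extending
    linear maps into each [I i]. *)
Definition cofree_fun i (x : cobj C i) : disk_obj i := (q i x, q (i + 1) (cd C i x)).
Lemma cofree_linear i : linear (@cofree_fun i).
Proof. by move=> a x y; rewrite /cofree_fun !linearP. Qed.
HB.instance Definition _ i := GRing.isLinear.Build R (cobj C i) (disk_obj i)
  _ (@cofree_fun i) (@cofree_linear i).
Definition cofree_m i : {linear cobj C i -> disk_obj i} := @cofree_fun i.
Lemma cofree_comm i x : cofree_m (i + 1) (cd C i x) = disk_d i (cofree_m i x).
Proof. by rewrite /= /cofree_fun cdd linear0. Qed.
Definition cofree : cmor C disk := @CMor _ C disk cofree_m cofree_comm.
End Cofree.

Lemma disk_injective : (forall i, injective_module (I i)) -> injective_complex disk.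
Proof.
move=> injI A C f u f_inj.
have ext i : exists q : {linear cobj C i -> I i},
    forall x, q (cm f i x) = (cm u i x).1.
  exact: (injI i _ _ (cm f i) (fst \o cm u i)).
exists (cofree (fun i => sval (cid (ext i)))) => i x /=; rewrite /cofree_fun.
case: cid => q /= ->; case: cid => q' /= q'E.
by rewrite -cm_comm q'E cm_comm [RHS]surjective_pairing.
Qed.
End Disk.

Lemma enough_injective_complexes B :
  exists J (j : cmor B J), injective_complex J /\ forall i, injective (cm j i).
Proof.
pose E i := cid (enough_injective_modules (cobj B i)).
have Einj i : injective_module (sval (E i)) by case: (svalP (E i)) => j [].
pose j i := cid (svalP (E i)).
exists (disk (fun i => sval (E i))), (cofree (fun i => sval (j i))).
split; first exact: disk_injective.
by move=> i x y [/(svalP (j i)).2].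
Qed.

End InjectiveComplexes.

(** * The envelope *)

Section Envelope.
Variables (R : pzRingType) (X : mclass R).
Hypotheses (Xext : closed_ext X) (Xquot : closed_quot X) (Xlim : closed_dirlim X).
Implicit Types B C D J T Y : complex R.

(** The right-hand side is killed by [g], so it has a unique preimage under [f]. As g f = 0, the
    formula contains r f = 1. *)
Lemma retract_of_section T Y D (f : cmor T Y) (g : cmor Y D) (s : cmor D Y) :
    ses_cx f g -> (forall i x, cm g i (cm s i x) = x) ->
  exists r : cmor Y T, forall i x, cm f i (cm r i x) = x - cm s i (cm g i x).
Proof.
move=> fg gs.
have [|||i x y xy|r rP] := @cmor_of_graph R Y T
  (fun i y t => cm f i t = y - cm s i (cm g i y)).
- move=> i y; have [_ [_ ex]] := fg i; apply/ex.
  by rewrite linearB gs subrr.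
- by move=> i a x x' y y' xy xy'; rewrite linearP xy xy' scalerBr addrACA -opprD !linearP.
- move=> i y; rewrite !linear0 addr0 => y0; have [inj _] := fg i.
  by apply: inj; rewrite y0 linear0.
- by rewrite !cm_comm xy linearB.
by exists r => i x; apply/rP.
Qed.

(** A lift [z] of [d] is corrected to z - f r z. Two lifts differ by an element of the image of [f],
    where 1 - f r vanishes. *)
Lemma section_of_retract T Y D (f : cmor T Y) (g : cmor Y D) (r : cmor Y T) :
    ses_cx f g -> (forall i x, cm r i (cm f i x) = x) ->
  exists s : cmor D Y, forall i x, cm g i (cm s i x) = x.
Proof.
move=> fg rf.
have [|||i _ _ [y <- ->]|s sP] := @cmor_of_graph R D Y
  (fun i d y => exists2 z, cm g i z = d & y = z - cm f i (cm r i z)).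
- move=> i d; have [_ [/(_ d)[z zd] _]] := fg i.
  by exists (z - cm f i (cm r i z)), z.
- move=> i a _ _ _ _ [z <- ->] [z' <- ->]; exists (a *: z + z'); first by rewrite linearP.
  by rewrite scalerBr addrACA -opprD !linearP.
- move=> i _ [z gz ->]; have [_ [_ ex]] := fg i.
  by have [t <-] := (ex z).1 gz; rewrite rf subrr.
- by exists (cd Y i y); rewrite ?cm_comm ?linearB.
exists s => i d; have [z <- ->] := (sP i d _).2 erefl.
have [_ [_ ex]] := fg i.
by rewrite linearB (_ : cm g i (cm f i _) = 0) ?subr0 //; apply/ex; exists (cm r i z).
Qed.

(** [w] factors through [p], and the factor from [N] to [P] is onto. *)
Lemma X_onto_ker (M N P : lmodType R) (p : {linear M -> N}) (w : {linear M -> P}) :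
    X N -> (forall y, exists x, p x = y) -> (forall y, exists x, w x = y) ->
    (forall x, p x = 0 -> w x = 0) ->
  X P.
Proof.
move=> XN p_onto w_onto pw.
have [|||g gP] := @linear_of_graph R N P (fun y z => exists2 x, p x = y & w x = z).
- by move=> y; have [x <-] := p_onto y; exists (w x), x.
- by move=> a _ _ _ _ [x <- <-] [x' <- <-]; exists (a *: x + x'); rewrite linearP.
- by move=> _ [x px <-]; apply: pw.
apply: (@Xquot N P g) => // z; have [x <-] := w_onto z.
by exists (p x); apply/esym/gP; exists x.
Qed.

(** A nonempty class closed under quotients contains the zero modules; this makes [B] itself a
    candidate in the Zorn argument. *)
Lemma X_zero (N M : lmodType R) : X N -> (forall x : M, x = 0) -> X M.
Proof.
move=> XN M0; apply: (@Xquot N M \0) => // y; exists 0.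
by rewrite linear0; apply/esym.
Qed.

Section ProductComplex.
Variables A C : complex R.
Definition prod_obj i : lmodType R := (cobj A i * cobj C i)%type.
Definition prod_dfun i (x : prod_obj i) : prod_obj (i + 1) := (cd A i x.1, cd C i x.2).
Lemma prod_d_linear i : linear (@prod_dfun i).
Proof. by move=> a x y; rewrite /prod_dfun !linearP. Qed.
HB.instance Definition _ i := GRing.isLinear.Build R (prod_obj i) (prod_obj (i + 1))
  _ (@prod_dfun i) (@prod_d_linear i).
Definition prod_d i : {linear prod_obj i -> prod_obj (i + 1)} := @prod_dfun i.
Lemma prod_dd i x : prod_d (i + 1) (prod_d i x) = 0.
Proof. by rewrite /= /prod_dfun /= !cdd. Qed.
Definition prodcx : complex R := Complex prod_dd.
End ProductComplex.

(* [Y] is the pushout of [phi] and [f]; a section of [Y -> D] makes [T'] a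
   retract of [Y]. *)
Lemma X_injective_extend B T D T' (phi : cmor B T) (p : cmor T D) (f : cmor B T') :
    X_injective X T' -> X_complex X D -> ses_cx phi p ->
  exists g : cmor T T', comp_eq g phi f.
Proof.
move=> XT' XD ses.
have pphi i b : cm p i (cm phi i b) = 0 by have [_ [_ ex]] := ses i; apply/ex; exists b.
(* The pushout is the cokernel of the antidiagonal map [d]. *)
have [||||d dP] := @cmor_of_graph R B (prodcx T' T)
  (fun i b y => y = (cm f i b, - cm phi i b)).
- by move=> i b; exists (cm f i b, - cm phi i b).
- by move=> i a x x' _ _ -> ->; rewrite !linearP.
- by move=> i _ ->; rewrite !linear0.
- by move=> i b _ ->; rewrite /= /prod_dfun /= linearN !cm_comm.
have dE i b : cm d i b = (cm f i b, - cm phi i b) by apply/esym/dP.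
pose Im := imcx d (topcx B); pose Y := quoC Im.
have [|||i x _ ->|il ilP] := @cmor_of_graph R T' Y (fun i x y => y = qpi (Im i) (x, 0)).
- by move=> i x; exists (qpi (Im i) (x, 0)).
- move=> i a x x' _ _ -> ->; rewrite -linearP; congr (qpi _ _).
  by rewrite [LHS]surjective_pairing /= scaler0 addr0.
- by move=> i _ ->; rewrite [RHS](_ : 0 = qpi (Im i) 0) ?linear0.
- by rewrite [LHS]quoC_dE /= /prod_dfun /= linear0.
have ilE i x : cm il i x = qpi (Im i) (x, 0) by apply/esym/ilP.
have [|||i _ _ [z <- ->]|ir irP] := @cmor_of_graph R Y D
  (fun i y e => exists2 z, qpi (Im i) z = y & e = cm p i z.2).
- by move=> i y; have [z <-] := qpi_onto y; exists (cm p i z.2), z.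
- by move=> i a _ _ _ _ [z <- ->] [z' <- ->]; exists (a *: z + z'); rewrite !linearP.
- by move=> i _ [z /qpi_eq0[b _ <-] ->]; rewrite dE /= linearN pphi oppr0.
- exists (prod_dfun z); first exact/esym/quoC_dE.
  by rewrite /= cm_comm.
have irE i z : cm ir i (qpi (Im i) z) = cm p i z.2 by apply/esym/irP; exists z.
have sesY : ses_cx il ir.
  move=> i; have [phi_inj [p_onto p_ker]] := ses i; split; [|split].
  - apply: raddf_inj => x x0.
    have /qpi_eq0[b _] : qpi (Im i) (x, 0) = 0 by rewrite -ilE.
    rewrite dE => -[<- /eqP]; rewrite oppr_eq0 => /eqP.
    by rewrite -(linear0 (cm phi i)) => /phi_inj ->; rewrite linear0.
  - by move=> e; have [t <-] := p_onto e; exists (qpi (Im i) (0, t)); rewrite irE.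
  - move=> y; split=> [|[x <-]]; last by rewrite ilE irE linear0.
    have [z <-] := qpi_onto y; rewrite irE => /p_ker[b bz].
    exists (z.1 + cm f i b); rewrite ilE; apply/subr0_eq.
    rewrite -linearB; apply/qpi_eq0; exists b => //.
    by rewrite dE [RHS]surjective_pairing /= addrC addKr sub0r bz.
have [s sP] := XT' _ _ _ _ XD sesY.
have [r rP] := retract_of_section sesY sP.
have il_inj i : injective (cm il i) by case: (sesY i).
(* The extension is the leg from [T] to the pushout followed by the retraction [r]. *)
have [|||i t _ ->|g gP] := @cmor_of_graph R T T'
  (fun i t x => x = cm r i (qpi (Im i) (0, t))).
- by move=> i t; exists (cm r i (qpi (Im i) (0, t))).
- move=> i a t t' _ _ -> ->; rewrite -!linearP; congr (cm r i (qpi _ _)).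
  by rewrite [LHS]surjective_pairing /= scaler0 addr0.
- move=> i _ ->; rewrite (_ : (0, 0) = 0 :> prod_obj T' T i) //.
  by rewrite !linear0.
- by rewrite -cm_comm [cd Y i _]quoC_dE /= /prod_dfun /= linear0.
exists g => i b; rewrite ((gP i _ _).2 erefl); apply: il_inj.
rewrite rP irE pphi linear0 subr0 ilE; apply/subr0_eq.
(* In the pushout (0, phi b) and (f b, 0) agree: their difference is [d] at - b. *)
rewrite -linearB; apply/qpi_eq0; exists (- b) => //.
by rewrite linearN dE [LHS]surjective_pairing [RHS]surjective_pairing /= sub0r opprK subr0.
Qed.

(** * Maximal essential extensions inside an injective complex *)

Section Main.
Variables (B J : complex R) (j : cmor B J).
Hypothesis j_inj : forall i, injective (cm j i).
Hypothesis J_inj : injective_complex J.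

Let B' := imcx j (topcx B).

(** The quotient of [S] by [B'] is taken as the image of [S] in the quotient of [J], so that a chain
    of candidates yields in each degree a chain of submodules of one fixed module. *)
Definition X_over (S : subcx J) :=
  [/\ sle B' S, essential S B'
    & forall i, X (subm (imm (qpi (B' i)) (S i)))].

Lemma X_over_max N : X N ->
  exists T : subcx J, X_over T /\ forall S, X_over S -> sle T S -> sle S T.
Proof.
move=> XN; have [||||T [XT _ maxT]] := @zorn_above _ (@sle R J) X_over B'; last by exists T.
- exact: sle_refl.
- exact: sle_trans.
- split=> // [K KB dK i x Kx|i]; first exact: dK (KB i x Kx).
  apply: X_zero XN _ => x; apply: submv_inj; rewrite linear0.
  by have [y /(qpi_eq0 _).2 <- <-] := submvP x.
- move=> F XF F0 chain; have [U UE] := chain_union F0 chain.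
  exists U => [|S FS i x Sx]; last by apply/UE; exists S.
  split=> [i x B'x|K KU dK i x Kx|i].
  + have [S FS] := F0; apply/UE; exists S => //.
    by have [BS _ _] := XF _ FS; apply: BS.
  + have /UE[S FS Sx] := KU _ _ Kx; have [_ eS _] := XF _ FS.
    (* An element of [K] lies in some member [S] of the chain; the part of [K] inside [S] is still
       disjoint from [B'], hence zero. *)
    apply: (eS (capcx K S)); [by move=> k y []| |by split].
    by move=> k y [Ky _]; apply: dK.
  + apply: (@chain_union_mclass R X _ (fun S' => exists2 S, F S & S' = imm (qpi (B' i)) (S i))) => //.
    * by have [S FS] := F0; exists (imm (qpi (B' i)) (S i)), S.
    * move=> _ _ [S FS ->] [S' FS' ->]; have [h|h] := chain _ _ FS FS'.
        by left=> x [y /h Sy <-]; exists y.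
      by right=> x [y /h Sy <-]; exists y.
    * move=> x; split=> [[y /UE[S FS Sy] <-]|[_ [S FS ->] [y Sy <-]]].
        by exists (imm (qpi (B' i)) (S i)); [exists S|exists y].
      by exists y => //; apply/UE; exists S.
    * by move=> _ [S FS ->]; have [] := XF _ FS.
Qed.


Variable T : subcx J.
Hypotheses (XT : X_over T) (maxT : forall S, X_over S -> sle T S -> sle S T).

(** S'/B' is an extension of S'/S by S/B'. As [w] maps [Y] onto [S'] and the kernel of [g] into [S],
    the module S'/S is a quotient of [D]. *)
Lemma imm_subset_quotient_X (S S' : subcx J) i (D Y : lmodType R)
    (g : {linear Y -> D}) (w : {linear Y -> cobj J i}) :
    sle S S' -> X (subm (imm (qpi (B' i)) (S i))) -> X D ->
    (forall d, exists y, g y = d) ->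
    (forall x, S' i x -> exists y, w y = x) -> (forall y, S' i (w y)) ->
    (forall y, g y = 0 -> S i (w y)) ->
  X (subm (imm (qpi (B' i)) (S' i))).
Proof.
move=> SS' XS XD g_onto w_onto wS' gS.
have iSS' x : imm (qpi (B' i)) (S i) x -> imm (qpi (B' i)) (S' i) x.
  by move=> [y /SS' Sy <-]; exists y.
pose m := subm_map iSS'.
apply: (@Xext _ _ _ m (qpi (imm m (topm _)))) XS _.
  split; [|split].
  - by move=> x y /(congr1 submv); rewrite !subm_mapE => /submv_inj.
  - exact: qpi_onto.
  - move=> y; split=> [/qpi_eq0[x _ <-]|[x <-]]; first by exists x.
    by apply/qpi_eq0; exists x.
have [|h hP] := @subm_lift R _ _ (imm (qpi (B' i)) (S' i)) (qpi (B' i) \o w).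
  by move=> y; exists (w y).
apply: (@X_onto_ker _ _ _ g (qpi (imm m (topm _)) \o h) XD g_onto) => [z|y gy0].
  have [x <-] := qpi_onto z; have [a /w_onto[y <-] ax] := submvP x.
  by exists y; congr (qpi _ _); apply: submv_inj; rewrite hP.
have Smy : imm (qpi (B' i)) (S i) (qpi (B' i) (w y)) by exists (w y); [exact: gS|].
have [x xE] := submv_onto Smy.
apply/qpi_eq0; exists x => //; apply: submv_inj.
by rewrite subm_mapE hP.
Qed.

Lemma max_X_injective : X_injective X (subC T).
Proof.
move=> Y D f g XD fg; have [BT eT XiT] := XT.
have f_inj i : injective (cm f i) by case: (fg i).
have f0 i x : cm f i x = 0 -> x = 0.
  by rewrite -(linear0 (cm f i)) => /f_inj.
have [K [dK maxK]] := maximal_disjoint (imcx f (topcx _)).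
have eK := essential_quotient dK maxK.
have [|v vE] := @J_inj (subC T) (quoC K) (ccomp (proj K) f) (incl T).
  move=> i; apply: raddf_inj => x /qpi_eq0 Kfx.
  by apply: (f0 i); apply: (dK i) => //; exists x.
(* [v] is injective on the image of [T], so its kernel meets that image trivially and vanishes by
   essentiality. *)
have v0 i y : cm v i y = 0 -> y = 0.
  apply: (eK (precx v (zerocx J))) => // k z vz [_ [t _ <-] zE].
  have t0 : t = 0 by apply: submv_inj; rewrite linear0 -[RHS]vz -zE; apply/esym/vE.
  by rewrite -zE t0 !linear0.
pose T' := imcx v (topcx (quoC K)).
have TT' : sle T T'.
  by move=> i x /submv_onto[t <-]; exists (cm (ccomp (proj K) f) i t); last exact: vE.
have T'T : sle T' T.
  apply: maxT => //; split=> [|L LT' dL i x Lx|i]; first exact: sle_trans TT'.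
    (* Essentiality is transitive: [L] is disjoint from [T] because [T] is essential over [B'], so
       its preimage in Y/K is disjoint from the image of [T], hence zero. *)
    have dLT : disjointcx L T.
      move=> k y Ly Ty; apply: (eT (capcx L T)) => // [l z []//|l z [Lz _]].
      exact: dL.
    have [y _ yx] := LT' i x Lx; rewrite -yx.
    suff -> : y = 0 by rewrite linear0.
    apply: (eK (precx v L)) => // [k z Lz [_ [t _ <-] zE]|]; last by rewrite /= yx.
    have vz : cm v k z = submv t by rewrite -zE; apply: vE.
    suff t0 : t = 0 by rewrite -zE t0 !linear0.
    apply: submv_inj; rewrite linear0; apply: (dLT k); last exact: submvP.
    by rewrite -vz.
  apply: (@imm_subset_quotient_X T T' i _ _ (cm g i) (cm (ccomp v (proj K)) i)) => //.
  - by case: (fg i) => _ [].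
  - by move=> _ [y _ <-]; have [z <-] := qpi_onto y; exists z.
  - by move=> y; exists (qpi (K i) y).
  - move=> y gy0; have [_ [_ ex]] := fg i; have [t <-] := (ex y).1 gy0.
    by rewrite [cm _ _ _]vE; apply: submvP.
(* As [T'] lies in [T], the map from [Y] to [J] lands in [T], where it is a retraction of [f]. *)
have [|r rE] := @subC_lift R Y J T (ccomp v (proj K)).
  by move=> i y; apply: T'T; exists (qpi (K i) y).
apply: (section_of_retract (r := r) fg) => i x; apply: submv_inj.
by rewrite rE; apply: vE.
Qed.

Variable phi : cmor B (subC T).
Hypothesis phiE : forall i b, submv (cm phi i b) = cm j i b.

Lemma phi_inj i : injective (cm phi i).
Proof. by move=> x y /(congr1 submv); rewrite !phiE => /j_inj. Qed.

Lemma max_essential (K : subcx (subC T)) :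
  disjointcx K (imcx phi (topcx B)) -> forall i x, K i x -> x = 0.
Proof.
move=> dK i x Kx; have [_ eT _] := XT; apply: submv_inj; rewrite linear0.
apply: (eT (imcx (incl T) K)) => [k _ [y _ <-]|k _ [y Ky <-] [b _ bE]|].
- exact: submvP.
- suff -> : y = 0 by rewrite linear0.
  apply: (dK k) => //; exists b => //; apply: submv_inj.
  by rewrite phiE.
- by exists x.
Qed.

(** This is T/B realized inside J/B', in the form used by the last clause of [X_over]. *)
Definition cokernel_cx := subC (imcx (proj B') T).
Lemma cokernel_X : X_complex X cokernel_cx.
Proof. by move=> i; have [_ _] := XT; apply. Qed.

Lemma cokernel_map : exists p : cmor (subC T) cokernel_cx, forall i,
  (forall y, exists x, cm p i x = y) /\
  (forall x, cm p i x = 0 <-> exists b, cm phi i b = x).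
Proof.
have [|p pE] := @subC_lift R (subC T) _ (imcx (proj B') T) (ccomp (proj B') (incl T)).
  by move=> i x; exists (submv x); first exact: submvP.
exists p => i; split=> [y|x].
  have [z Tz zy] := submvP y; have [x xz] := submv_onto Tz.
  by exists x; apply: submv_inj; rewrite pE -zy -xz.
split=> [px|[b <-]].
  have /qpi_eq0[b _ bx] : qpi (B' i) (submv x) = 0.
    by have := pE i x; rewrite px linear0 => /esym.
  by exists b; apply: submv_inj; rewrite phiE.
by apply: submv_inj; rewrite pE linear0; apply/qpi_eq0; exists b.
Qed.

Lemma max_automorphism (h : cmor (subC T) (subC T)) :
  comp_eq h phi phi -> is_automorphism h.
Proof.
move=> hphi; have h0 i x : cm h i x = 0 -> x = 0.
  apply: (@max_essential (precx h (zerocx _))) => k y /= hy [b _ by_].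
  by rewrite -by_ -hphi by_.
have h_inj i : injective (cm h i) by apply: raddf_inj => x /h0.
have [p pP] := cokernel_map.
pose H := imcx h (topcx _).
have hq : ses_cx h (proj H).
  move=> i; split; first exact: h_inj; split; first exact: qpi_onto.
  by move=> y; split=> [/qpi_eq0[x _ <-]|[x <-]]; [exists x|apply/qpi_eq0; exists x].
have XH : X_complex X (quoC H).
  move=> i; have [p_onto p_ker] := pP i.
  (* T/h(T) is a quotient of T/B, because h(T) contains h(phi(B)) = phi(B). *)
  apply: (@X_onto_ker _ _ _ (cm p i) (qpi (H i)) (cokernel_X i)) => //.
    exact: qpi_onto.
  by move=> x /p_ker[b <-]; apply/qpi_eq0; exists (cm phi i b).
have [s sP] := max_X_injective XH hq.
have s0 i d : cm s i d = 0.
  (* An element s(e) in phi(B) lies in h(T), so its class [e] is zero: the image of [s] is disjoint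
     from phi(B). *)
  apply: (@max_essential (imcx s (topcx _))); last by exists d.
  move=> k _ [e _ <-] [b _ be]; suff -> : e = 0 by rewrite linear0.
  by rewrite -(sP k e) -be; apply/qpi_eq0; exists (cm phi k b).
have h_onto i y : exists x, cm h i x = y.
  have /qpi_eq0[x _ <-] : qpi (H i) y = 0; last by exists x.
  by rewrite -[LHS](sP i) s0 linear0.
have [||||k kP] := @cmor_of_graph R (subC T) (subC T) (fun i y x => cm h i x = y).
- exact: h_onto.
- by move=> i a x x' y y' <- <-; rewrite linearP.
- by move=> i y /h0.
- by move=> i x y <-; rewrite cm_comm.
exists k; split=> i x; first exact/esym/kP.
exact/(kP i).
Qed.

Lemma max_envelope : X_inj_envelope X phi.
Proof.
split; first exact: max_X_injective.
split=> [T' f XT'|h]; last exact: max_automorphism.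
have [p pP] := cokernel_map.
apply: (X_injective_extend (p := p)) => //; first exact: cokernel_X.
by move=> i; have [p_onto p_ker] := pP i; split; first exact: phi_inj.
Qed.

End Main.
End Envelope.

Theorem theorem2p26 (R : pzRingType) (X : mclass R)
  (Hext : closed_ext X) (Hquot : closed_quot X) (Hlim : closed_dirlim X)
  (B : complex R) :
  exists (T : complex R) (phi : cmor B T), X_inj_envelope X phi.
Proof.
have [[N XN]|X0] := pselect (exists N, X N); last first.
  (* If [X] is empty, there are no [X]-complexes, and [B] is its own envelope. *)
  exists B, (@CMor _ B B (fun i => idfun) (fun _ _ => erefl)); split.
    by move=> Y D f g XD; case: X0; exists (cobj D 0).
  split=> [T' f _|h hid]; first by exists f.
  by exists (@CMor _ B B (fun i => idfun) (fun _ _ => erefl)); split=> i x; apply: hid.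
have [J [j [J_inj j_inj]]] := enough_injective_complexes B.
have [T [XT maxT]] := X_over_max Hquot Hlim j XN.
have [|phi phiE] := @subC_lift R B J T j.
  by move=> i b; have [BT _ _] := XT; apply: BT; exists b.
by exists (subC T), phi; apply: (max_envelope Hext Hquot j_inj J_inj XT maxT phiE).
Qed.
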